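(* Let $c$ be an arbitrary non-negative real-valued function on the positive integers. Put $\Delta(2)=3$ and, for each integer $n>2$, let $\Delta(n)$ be an element of $\operatorname{Argmin}_{d\in\{3,\dots,n\}} \frac{c(d)}{d-2}$. Then for every integer $n\ge 2$ and every tree $T$ with $n$ pendent vertices, $$C(T) \ge \underline{C}(n) := n\,c(1) + (n-2)\frac{c(\Delta(n))}{\Delta(n)-2}.$$ Moreover, when $q(n):=\frac{n-2}{\Delta(n)-2}$ is an integer, the equality $C(T)=\underline{C}(n)$ is achieved at an arbitrary tree $T$ with $n$ pendent vertices in which all internal vertices have degree $\Delta(n)$.
   Context: Graphs are finite, simple, connected and undirected; a tree is a connected graph with $N$ vertices and $N-1$ edges. $V(T)$ is the vertex set of $T$, and $d_T(v)$ is the degree of a vertex $v$ in $T$. A vertex is pendent if it has degree $1$; the other vertices are called internal. For a non-negative function $c(\cdot)$ of the vertex degree, the cost of a graph $G$ is $C(G):=\sum_{v\in V(G)} c(d_G(v))$. *)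

(* Defs.v *)
From mathcomp Require Import all_boot all_order all_algebra.
From mathcomp Require Import reals.

Set Implicit Arguments.
Unset Strict Implicit.
Unset Printing Implicit Defensive.

Import Order.TTheory GRing.Theory Num.Theory.
Local Open Scope ring_scope.

Record sgraph := SGraph {
  vertex :> finType;
  adj : rel vertex;
  adj_sym : symmetric adj;
  adj_irr : irreflexive adj
}.

Definition deg (G : sgraph) (v : G) : nat := #|[set w : G | adj v w]|.

Definition edges (G : sgraph) : {set {set G}} :=
  [set [set p.1; p.2] | p : G * G & adj p.1 p.2].

Definition connected_graph (G : sgraph) : Prop :=
  forall x y : G, connect (@adj G) x y.

(* The additive form of the edge count also rules out the empty graph. *)
Definition is_tree (G : sgraph) : Prop :=
  connected_graph G /\ #|G| = #|edges G|.+1.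

Definition pendent (G : sgraph) : {set G} := [set v : G | deg v == 1%N].

(* Functions on the positive integers are represented by functions on nat whose
   value at 0 is never constrained; it enters the cost only of graphs with an
   isolated vertex, hence never that of a tree with at least two vertices. *)
Definition cost (R : realType) (c : nat -> R) (G : sgraph) : R :=
  \sum_(v : G) c (deg v).

Definition unit_cost (R : realType) (c : nat -> R) (d : nat) : R :=
  c d / (d%:R - 2%:R).

Definition is_argmin (R : realType) (f : nat -> R) (a b m : nat) : Prop :=
  (a <= m <= b)%N /\ forall d : nat, (a <= d <= b)%N -> f m <= f d.

Definition cost_lb (R : realType) (c : nat -> R) (Delta : nat -> nat)
    (n : nat) : R :=
  n%:R * c 1%N + (n%:R - 2%:R) * unit_cost c (Delta n).

Definition q (R : realType) (Delta : nat -> nat) (n : nat) : R :=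
  (n%:R - 2%:R) / ((Delta n)%:R - 2%:R).

Definition internally_regular (Delta : nat -> nat) (n : nat) (T : sgraph) : Prop :=
  [/\ is_tree T, #|pendent T| = n &
      forall v : T, v \notin pendent T -> deg v = Delta n].

(* Main.v *)
Require Import Defs.
From mathcomp Require Import all_boot all_order all_algebra.
From mathcomp Require Import reals.
From mathcomp Require Import zify ring.

Set Implicit Arguments.
Unset Strict Implicit.
Unset Printing Implicit Defensive.

Import Order.TTheory GRing.Theory Num.Theory.
Local Open Scope ring_scope.

(** Why the bound holds.  A tree has one edge fewer than vertices, so by the
    handshake lemma the excesses [deg v - 2] of its vertices add up to [-2].
    Each of the [n] pendent vertices has excess [-1], hence the excesses of the
    internal vertices add up to [n - 2] ([tree_excess]), whatever the tree.
    The unit cost [c d / (d - 2)] is the price that an internal vertex of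
    degree [d] pays for one unit of excess.  A tree thus has to buy [n - 2]
    units of excess, and the cheapest unit price is that of degree [Delta n]:
    this gives the lower bound ([cost_lower_bound]), with equality when every
    internal vertex pays exactly this price ([cost_internally_regular]).  Two
    points need care.  The degrees among which [Delta n] is optimal stop at
    [n]; since internal excesses are non-negative and add up to [n - 2], no
    vertex has degree above [n] ([internal_deg_bounds]).  And a vertex of
    degree 2 buys nothing, so that its cost only has to be non-negative.

    Why the bound is attained when [(n - 2) / (Delta n - 2)] is an integer [k].
    One exhibits a tree with [k] internal vertices, all of degree [m + 1] with
    [m = Delta n - 1] ([regular_tree]): number the vertices in breadth-first
    order from a leaf 0, let 0 have the single child 1, and give each of the
    vertices 1, ..., k the next [m] numbers as children. *)

(** * Degrees and excess in a tree *)

Section Degrees.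
Variable G : sgraph.
Local Open Scope nat_scope.

(** Both sides count the arcs, that is, the ordered pairs of adjacent vertices:
    by their origin on the left, and by their underlying edge on the right,
    each edge carrying two arcs. *)
Lemma handshake : \sum_(v : G) deg v = 2 * #|edges G|.
Proof.
pose arcs := [set p : G * G | adj p.1 p.2].
have -> : \sum_(v : G) deg v = \sum_(p in arcs) 1.
  rewrite (eq_bigl (fun p : G * G => true && adj p.1 p.2)); last first.
    by move=> p; rewrite inE.
  rewrite -(pair_big_dep xpredT (fun v w => adj v w) (fun _ _ => 1)) /=.
  by apply: eq_bigr => v _; rewrite /deg -sum1dep_card.
rewrite (partition_big_imset (fun p : G * G => [set p.1; p.2])) /=.
rewrite -/(edges G).
transitivity (\sum_(e in edges G) 2); last by rewrite sum_nat_const mulnC.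
apply: eq_bigr => e /imsetP[[x y] /= xy ->].
rewrite inE /= in xy.
have nxy : x != y by apply: contraTneq xy => ->; rewrite adj_irr.
rewrite sum1dep_card -(_ : #|[set (x, y); (y, x)]| = 2); last first.
  by rewrite cards2 xpair_eqE (negPf nxy).
apply: eq_card => -[a b]; rewrite !inE !xpair_eqE /=.
apply/andP/orP => [[ab /eqP E]|].
  have nab : a != b by apply: contraTneq ab => ->; rewrite adj_irr.
  have : a \in [set x; y] by rewrite -E !inE eqxx.
  have : b \in [set x; y] by rewrite -E !inE eqxx orbT.
  move: nab; rewrite !inE => nab.
  by case/orP=> /eqP ?; case/orP=> /eqP ?; subst; rewrite ?eqxx in nab *; auto.
case=> /andP[/eqP -> /eqP ->]; first by [].
by rewrite adj_sym setUC.
Qed.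

Lemma deg_gt0 (v : G) : connected_graph G -> 1 < #|G| -> 0 < deg v.
Proof.
move=> Gconn G1; have [w vw] : exists w : G, w != v.
  apply/existsP; apply: contraTT G1; rewrite negb_exists => /forallP Gv.
  rewrite -leqNgt -(card1 v); apply/subset_leq_card/subsetP => w _.
  by rewrite inE; apply: negbNE.
have /connectP[[|u s] /=] := Gconn v w; first by move=> _ E; rewrite E eqxx in vw.
by case/andP=> vu _ _; apply/card_gt0P; exists u; rewrite inE.
Qed.

End Degrees.

(** The number of pendent vertices alone fixes the total excess of the internal
    ones: this is what makes costs of different trees comparable. *)
Lemma tree_excess (R : realType) (T : sgraph) : is_tree T ->
  \sum_(v : T | v \notin pendent T) ((deg v)%:R - 2%:R) =
  #|pendent T|%:R - 2%:R :> R.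
Proof.
case=> _ cardT.
have : \sum_(v : T) ((deg v)%:R - 2%:R) = - 2%:R :> R.
  rewrite sumrB -natr_sum handshake sumr_const cardT natrM.
  by rewrite -[2%:R *+ _]mulr_natr -natr1; ring.
rewrite (bigID (mem (pendent T))) /=.
have -> : \sum_(v in pendent T) ((deg v)%:R - 2%:R) = - #|pendent T|%:R :> R.
  transitivity (\sum_(v in pendent T) - 1 : R); last by rewrite sumr_const mulNrn.
  by apply: eq_bigr => v; rewrite inE => /eqP ->; ring.
by move/(canRL (addKr _)) ->; ring.
Qed.

(** * The bound and its equality case *)

Section Cost.
Variables (R : realType) (c : nat -> R) (Delta : nat -> nat).

Lemma cost_internal (T : sgraph) :
  cost c T = #|pendent T|%:R * c 1%N + \sum_(v | v \notin pendent T) c (deg v).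
Proof.
rewrite /cost (bigID (mem (pendent T))) /=; congr (_ + _).
rewrite mulr_natl -sumr_const; apply: eq_bigr => v.
by rewrite inE => /eqP ->.
Qed.

(** The bound is the cost that the tree would have if each internal vertex paid
    the optimal price for its excess; this reduces both the inequality and the
    equality case to a comparison vertex by vertex. *)
Lemma cost_lb_internal (T : sgraph) : is_tree T ->
  cost_lb c Delta #|pendent T| = #|pendent T|%:R * c 1%N +
    \sum_(v | v \notin pendent T)
       ((deg v)%:R - 2%:R) * unit_cost c (Delta #|pendent T|).
Proof. by move=> treeT; rewrite -mulr_suml tree_excess. Qed.

Lemma unit_costK d : (2 < d)%N -> (d%:R - 2%:R) * unit_cost c d = c d.
Proof.
move=> d2; rewrite mulrC divfK // subr_eq0 eqr_nat.
by rewrite gtn_eqF.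
Qed.

(** A single internal vertex cannot have more than the total excess [n - 2],
    since the other internal vertices contribute non-negatively; here [n] is the number
    of pendent vertices. *)
Lemma internal_deg_bounds (T : sgraph) (v : T) :
  is_tree T -> (1 < #|pendent T|)%N -> v \notin pendent T ->
  (2 <= deg v <= #|pendent T|)%N.
Proof.
move=> treeT n2; have [Tconn _] := treeT.
have T1 : (1 < #|T|)%N by apply: leq_trans n2 (max_card _).
have deg2 (u : T) : u \notin pendent T -> (2 <= deg u)%N.
  by rewrite inE => u1; have := deg_gt0 u Tconn T1; case: (deg u) u1 => [|[]].
move=> vI; rewrite deg2 //= -(ler_nat R) -(lerD2r (- 2%:R)) -tree_excess //.
rewrite (bigD1 v) //= lerDl sumr_ge0 // => u /andP[uI _].
by rewrite subr_ge0 ler_nat deg2.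
Qed.

Lemma cost_lower_bound (T : sgraph) :
  (forall d, (0 < d)%N -> 0 <= c d) ->
  ((2 < #|pendent T|)%N ->
     is_argmin (unit_cost c) 3 #|pendent T| (Delta #|pendent T|)) ->
  (2 <= #|pendent T|)%N -> is_tree T ->
  cost_lb c Delta #|pendent T| <= cost c T.
Proof.
move=> c_ge0 argminD n2 treeT.
rewrite cost_lb_internal // cost_internal lerD2l ler_sum // => v vI.
have /andP[] := internal_deg_bounds treeT n2 vI.
rewrite leq_eqVlt => /orP[/eqP <- _|d3 dn].
  (* A vertex of degree 2 has no excess. *)
  by rewrite subrr mul0r c_ge0.
have [_ minD] := argminD (leq_trans d3 dn).
rewrite -[leRHS]unit_costK // ler_wpM2l ?minD ?d3 //.
by rewrite subr_ge0 ler_nat ltnW.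
Qed.

Lemma cost_internally_regular (T : sgraph) n :
  (2 < Delta n)%N -> internally_regular Delta n T ->
  cost c T = cost_lb c Delta n.
Proof.
move=> D2 [treeT nT degT]; rewrite -{n}nT in D2 degT *.
rewrite cost_lb_internal // cost_internal; congr (_ + _).
by apply: eq_bigr => v vI; rewrite degT // unit_costK.
Qed.

End Cost.

(** * Trees given by a parent function *)

Section ParentGraph.
Local Open Scope nat_scope.
Variables (p : nat -> nat) (N : nat).

(** Requiring the parent to be the smaller end makes the relation symmetric and
    irreflexive for every [p], and discards the value of [p] at the root 0. *)
Definition parent_adj : rel 'I_N.+1 :=
  fun x y => (x < y) && (p y == x) || (y < x) && (p x == y).

Lemma parent_adj_sym : symmetric parent_adj.
Proof. by move=> x y; rewrite /parent_adj orbC. Qed.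

Lemma parent_adj_irr : irreflexive parent_adj.
Proof. by move=> x; rewrite /parent_adj ltnn. Qed.

Definition parent_graph := SGraph parent_adj_sym parent_adj_irr.

Hypothesis p_lt : forall i, 0 < i -> p i < i.

Let par (i : 'I_N.+1) : 'I_N.+1 := inord (p i).

Let parE (i : 'I_N.+1) : 0 < i -> par i = p i :> nat.
Proof.
by move=> i0; rewrite inordK // (ltn_trans (p_lt i0)).
Qed.

Let adj_par (i : 'I_N.+1) : 0 < i -> parent_adj i (par i).
Proof. by move=> i0; rewrite /parent_adj parE // p_lt // eqxx orbT. Qed.

Lemma parent_graph_connected : connected_graph parent_graph.
Proof.
have root (x : parent_graph) : connect (@adj parent_graph) x ord0.
  elim/ltn_ind: {x}(val x) {-2}x (erefl (val x)) => k IH x xk.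
  have [x0|x0] := posnP x; first by rewrite (_ : x = ord0) //; apply: val_inj.
  apply: connect_trans (connect1 (adj_par x0)) (IH (p k) _ _ _).
    by rewrite -xk p_lt.
  by rewrite /= parE // -xk.
have csym : connect_sym (@adj parent_graph).
  exact/sym_connect_sym/adj_sym.
by move=> x y; apply: connect_trans (root x) _; rewrite csym.
Qed.

(** Every vertex but the root owns the edge to its parent, which is why there
    are [N] edges for [N.+1] vertices. *)
Lemma parent_graph_edges :
  edges parent_graph = [set [set i; par i] | i in [set~ ord0]].
Proof.
apply/setP=> e; apply/imsetP/imsetP => -[].
  case=> x y /= xy ->; move: xy.
  rewrite inE /= /parent_adj => /orP[] /andP[lt_xy /eqP E].
    exists y; first by rewrite !inE -lt0n (leq_ltn_trans _ lt_xy).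
    by rewrite setUC; congr [set _; _]; apply: val_inj; rewrite /= inordK E.
  exists x; first by rewrite !inE -lt0n (leq_ltn_trans _ lt_xy).
  by congr [set _; _]; apply: val_inj; rewrite /= inordK E.
move=> i; rewrite !inE -lt0n => i0 ->; exists (i, par i) => //.
by rewrite inE; apply: adj_par.
Qed.

(** Two vertices owning the same edge are equal, because the owner is the larger
    end of its edge. *)
Lemma parent_graph_tree : is_tree parent_graph.
Proof.
split; first exact: parent_graph_connected.
rewrite parent_graph_edges card_in_imset ?cardsC1 ?card_ord // => i j.
rewrite !inE -!lt0n => i0 j0 E; apply: val_inj => /=.
have pi := p_lt i0; have pj := p_lt j0.
have : i \in [set j; par j] by rewrite -E !inE eqxx.
have : j \in [set i; par i] by rewrite E !inE eqxx.
have := parE i0; have := parE j0; move: pi pj.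
by rewrite !inE -!val_eqE /= => ? ? -> ->; lia.
Qed.

Lemma deg_parent_graph (v : parent_graph) :
  deg v = (0 < v) + #|[set y : 'I_N.+1 | (v < y) && (p y == v)]|.
Proof.
have -> : nat_of_bool (0 < v) = #|[set y : 'I_N.+1 | (y < v) && (p v == y)]|.
  have [v0|v0] := posnP v.
    by apply/esym/eqP; rewrite cards_eq0; apply/eqP/setP => y; rewrite !inE v0.
  transitivity #|[set par v]|; first by rewrite cards1.
  apply: eq_card => y.
  rewrite !inE -val_eqE /= parE //.
  by have := p_lt v0; lia.
rewrite /deg -cardsUI [X in _ = (_ + X)%N](_ : _ = 0) ?addn0; last first.
  by apply/eqP; rewrite cards_eq0; apply/eqP/setP => y; rewrite !inE; lia.
by apply: eq_card => y; rewrite !inE /= /parent_adj orbC.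
Qed.

End ParentGraph.

(** * A tree with all internal degrees equal *)

Lemma card_ord_interval N a b : (b <= N)%N ->
  #|[set i : 'I_N | (a <= i < b)%N]| = (b - a)%N.
Proof.
move=> bN; rewrite -sum1dep_card.
rewrite -(big_ord_widen_cond N (fun i => a <= i)%N (fun=> 1%N)) //.
by rewrite -(big_geq_mkord a b xpredT (fun=> 1%N)) sum_nat_const_nat muln1.
Qed.

Section RegularTree.
Local Open Scope nat_scope.
Variables m k : nat.
Hypothesis m_gt0 : 0 < m.

(** For [i > 0] this is the ceiling of [(i - 1) / m]: vertex 1 is the only
    child of 0, and the children of [v > 0] are the [m] vertices from
    [(v - 1) m + 2] to [v m + 1]. *)
Definition ceil_parent i := (i + m - 2) %/ m.

Lemma ceil_parent_lt i : 0 < i -> ceil_parent i < i.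
Proof. by move=> i0; rewrite /ceil_parent ltn_divLR //; nia. Qed.

Lemma ceil_parentE v i :
  (v < i) && (ceil_parent i == v) =
  ((if v == 0 then 1 else (v.-1 * m).+2) <= i < (v * m).+2).
Proof.
rewrite /ceil_parent.
have := divn_eq (i + m - 2) m; have := ltn_pmod (i + m - 2) m_gt0.
move: (_ %/ m) (_ %% m) => d r r_lt E.
case: v => [|v] /=.
  by rewrite mul0n; nia.
by apply/idP/idP; nia.
Qed.

(** The vertices are 0, ..., [k m + 1], the last one being the last child of
    vertex [k]; the vertices after [k] are therefore childless, and those from 1
    to [k] have all their [m] children. *)
Definition regular_tree := parent_graph ceil_parent (k * m).+1.

Lemma regular_tree_tree : is_tree regular_tree.
Proof. exact/parent_graph_tree/ceil_parent_lt. Qed.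

Lemma deg_regular_tree (v : regular_tree) :
  deg v = if 0 < v <= k then m.+1 else 1.
Proof.
rewrite deg_parent_graph; last exact: ceil_parent_lt.
rewrite (eq_card (B := [set y : 'I_(k * m).+2 |
   (if v == 0 :> nat then 1 else (v.-1 * m).+2) <= y
     < minn (v * m).+2 (k * m).+2])).
  rewrite card_ord_interval ?geq_minr //.
  by case: (posnP v) => [->|v0] /=; [lia | case: ifP; nia].
move=> y; rewrite !inE ceil_parentE.
by have := ltn_ord y; lia.
Qed.

Lemma card_pendent_regular_tree : 1 < m ->
  #|pendent regular_tree| = k * m.-1 + 2.
Proof.
move=> m1; have := cardC [set v : regular_tree | 1 <= v < k.+1].
rewrite card_ord_interval ?card_ord; last by nia.
rewrite (eq_card (B := pendent regular_tree)); first by nia.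
move=> v; rewrite !inE deg_regular_tree ltnS.
by case: ifP; lia.
Qed.

End RegularTree.

Theorem theorem2 (R : realType) (c : nat -> R)
    (c_ge0 : forall d : nat, (0 < d)%N -> 0 <= c d)
    (Delta : nat -> nat)
    (Delta2 : Delta 2%N = 3%N)
    (Delta_argmin : forall n : nat, (2 < n)%N ->
       is_argmin (unit_cost c) 3 n (Delta n))
    (n : nat) (n_ge2 : (2 <= n)%N) :
  (forall T : sgraph, is_tree T -> #|pendent T| = n ->
     cost_lb c Delta n <= cost c T) /\
  (q R Delta n \is a Num.int ->
     (exists T : sgraph, internally_regular Delta n T) /\
     (forall T : sgraph, internally_regular Delta n T ->
        cost c T = cost_lb c Delta n)).
Proof.
(* For [n = 2] the degree 3 is prescribed so that the price is well defined. *)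
have D_gt2 : (2 < Delta n)%N.
  have [n3|n2] := ltnP 2 n; first by have [/andP[]] := Delta_argmin n n3.
  by rewrite (_ : n = 2%N) ?Delta2 //; lia.
split=> [T treeT nT|q_int].
  by rewrite -nT in n_ge2 *; apply: cost_lower_bound => //; apply: Delta_argmin.
split; last by move=> T; apply: cost_internally_regular.
have DB_gt0 : 0 < (Delta n)%:R - 2%:R :> R by rewrite subr_gt0 ltr_nat.
have q_ge0 : 0 <= q R Delta n.
  by rewrite divr_ge0 ?(ltW DB_gt0) // subr_ge0 ler_nat.
have /natrP[k qk] : q R Delta n \is a Num.nat by rewrite natrEint q_int.
have nE : n = (k * (Delta n).-2 + 2)%N.
  apply/eqP; rewrite -(eqr_nat R) natrD natrM -subn2 natrB; last exact: ltnW.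
  by rewrite -qk divfK ?subrK // lt0r_neq0.
have m1 : (1 < (Delta n).-1)%N by lia.
have m0 := ltnW m1.
(* Vertices of degree [Delta n] have [Delta n - 1] children besides a parent. *)
exists (regular_tree (Delta n).-1 k); split.
- exact: regular_tree_tree.
- by rewrite card_pendent_regular_tree // [RHS]nE.
- move=> v; rewrite inE deg_regular_tree //.
  by case: ifP => // _ _; lia.
Qed.
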